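(* Let $k$ be a field and let $\mathcal{T}$ be a Hom-finite Krull-Schmidt triangulated $k$-category which is connected, 2-Calabi-Yau (2-CY), and has finitely many isomorphism classes of indecomposable objects. If $T$ is an object in $\mathcal{T}$ such that the functor $\operatorname{Hom}_{\mathcal{T}}(T,-):\mathcal{T}\to\operatorname{mod}\Gamma$ is full and dense, where $\Gamma=\operatorname{End}_{\mathcal{T}}(T)^{\mathrm{op}}$, then $T$ is either Schurian or a 2-cluster-tilting object in $\mathcal{T}$.
   Context: $\Sigma$ denotes the suspension functor of $\mathcal{T}$, and $\operatorname{mod}\Gamma$ the category of finitely generated (left) $\Gamma$-modules. A Serre functor on $\mathcal{T}$ is an autoequivalence $\mathbb{S}:\mathcal{T}\to\mathcal{T}$ such that for each object $X$ there is an isomorphism $D\operatorname{Hom}_{\mathcal{T}}(X,-)\cong\operatorname{Hom}_{\mathcal{T}}(-,\mathbb{S}X)$, where $D=\operatorname{Hom}_k(-,k)$. A triangulated category with Serre functor $\mathbb{S}$ is $d$-Calabi-Yau if $\mathbb{S}=\Sigma^d$ and $d$ is the smallest positive integer for which this holds; 2-CY means $d=2$. An object $X$ is Schurian if $\operatorname{End}_{\mathcal{T}}(X)^{\mathrm{op}}\cong k$. An object $T$ is a cluster-tilting object (here also called 2-cluster-tilting) if $\operatorname{add}(T)=\{X\mid\operatorname{Hom}_{\mathcal{T}}(T,\Sigma X)=0\}=\{X\mid\operatorname{Hom}_{\mathcal{T}}(X,\Sigma T)=0\}$, where $\operatorname{add}(T)$ is the class of direct summands of finite direct sums of copies of $T$.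 *)

(* Defs.v *)
From HB Require Import structures.
From mathcomp Require Import all_boot all_order all_algebra.

Set Implicit Arguments.
Unset Strict Implicit.
Unset Printing Implicit Defensive.

Import GRing.Theory.
Local Open Scope ring_scope.

(** * Hom-finite k-linear categories *)

(* [vectType k] is the type of finite-dimensional k-vector spaces, so
   Hom-finiteness is part of the structure. *)
Record linCat (k : fieldType) := LinCat {
  cobj :> Type;
  mor : cobj -> cobj -> vectType k;
  idm : forall X, mor X X;
  mcomp : forall X Y Z, mor Y Z -> mor X Y -> mor X Z;
  compA : forall W X Y Z (h : mor Y Z) (g : mor X Y) (f : mor W X),
    mcomp h (mcomp g f) = mcomp (mcomp h g) f;
  comp1m : forall X Y (f : mor X Y), mcomp (idm Y) f = f;
  compm1 : forall X Y (f : mor X Y), mcomp f (idm X) = f;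
  comp_linearl : forall X Y Z (a : k) (g g' : mor Y Z) (f : mor X Y),
    mcomp (a *: g + g') f = a *: mcomp g f + mcomp g' f;
  comp_linearr : forall X Y Z (a : k) (g : mor Y Z) (f f' : mor X Y),
    mcomp g (a *: f + f') = a *: mcomp g f + mcomp g f' }.

Arguments mor {k _} X Y.
Arguments idm {k _} X.
Arguments mcomp {k _ X Y Z} g f.

Notation "g \oc f" := (mcomp g f) (at level 40, left associativity).

Definition is_iso (k : fieldType) (C : linCat k) (X Y : C) (f : mor X Y) :=
  exists g : mor Y X, g \oc f = idm X /\ f \oc g = idm Y.

Definition isomorphic (k : fieldType) (C : linCat k) (X Y : C) :=
  exists f : mor X Y, is_iso f.

Definition is_zero (k : fieldType) (C : linCat k) (X : C) :=
  forall Y : C, (forall f : mor X Y, f = 0) /\ (forall f : mor Y X, f = 0).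

Definition is_dirsum (k : fieldType) (C : linCat k) (I : finType)
    (Xs : I -> C) (X : C) :=
  exists (inj : forall i, mor (Xs i) X) (prj : forall i, mor X (Xs i)),
    [/\ forall i, prj i \oc inj i = idm (Xs i),
        forall i j, i != j -> prj j \oc inj i = 0
      & \sum_i (inj i \oc prj i) = idm X].

Definition is_dirsum2 (k : fieldType) (C : linCat k) (A B X : C) :=
  is_dirsum (fun b : bool => if b then A else B) X.

(* The case n = 0 provides a zero object. *)
Definition is_additive (k : fieldType) (C : linCat k) :=
  forall (n : nat) (Xs : 'I_n -> C), exists X : C, is_dirsum Xs X.

Definition indecomposable (k : fieldType) (C : linCat k) (X : C) :=
  ~ is_zero X /\ forall A B : C, is_dirsum2 A B X -> is_zero A \/ is_zero B.

Definition in_add (k : fieldType) (C : linCat k) (T X : C) :=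
  exists (n : nat) (S X' : C),
    is_dirsum (fun _ : 'I_n => T) S /\ is_dirsum2 X X' S.

(* A ring is local if it is nonzero and its non-units are closed under
   addition. *)
Definition has_local_end (k : fieldType) (C : linCat k) (X : C) :=
  (idm X : mor X X) <> 0 /\
  forall f g : mor X X, is_iso (f + g) -> is_iso f \/ is_iso g.

Definition krull_schmidt (k : fieldType) (C : linCat k) :=
  forall X : C, exists (n : nat) (Xs : 'I_n -> C),
    is_dirsum Xs X /\ forall i, has_local_end (Xs i).

(* Connected as an additive category: C is not the direct product of two
   nonzero full additive subcategories, whether or not these are stable under
   suspension. *)
Definition connected (k : fieldType) (C : linCat k) :=
  forall P Q : C -> Prop,
    (forall A B, P A -> Q B ->
       (forall f : mor A B, f = 0) /\ (forall f : mor B A, f = 0)) ->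
    (forall X, exists A B, [/\ P A, Q B & is_dirsum2 A B X]) ->
    (forall A, P A -> is_zero A) \/ (forall B, Q B -> is_zero B).

Definition finitely_many_indecomposables (k : fieldType) (C : linCat k) :=
  exists (n : nat) (Xs : 'I_n -> C),
    forall X : C, indecomposable X -> exists i, isomorphic X (Xs i).

(** * k-linear functors *)

Record linFunctor (k : fieldType) (C D : linCat k) := LinFunctor {
  fobj :> C -> D;
  fmap : forall X Y : C, mor X Y -> mor (fobj X) (fobj Y);
  fmap1 : forall X, fmap (idm X) = idm (fobj X);
  fmapM : forall X Y Z (g : mor Y Z) (f : mor X Y),
    fmap (g \oc f) = fmap g \oc fmap f;
  fmap_linear : forall X Y (a : k) (f g : mor X Y),
    fmap (a *: f + g) = a *: fmap f + fmap g }.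

Arguments fmap {k C D} F {X Y} f : rename.

Definition idF (k : fieldType) (C : linCat k) : linFunctor C C :=
  @LinFunctor k C C id (fun X Y f => f) (fun=> erefl)
    (fun _ _ _ _ _ => erefl) (fun _ _ _ _ _ => erefl).

Program Definition compF (k : fieldType) (C D E : linCat k)
    (G : linFunctor D E) (F : linFunctor C D) : linFunctor C E :=
  @LinFunctor k C E (fun X => G (F X)) (fun X Y f => fmap G (fmap F f)) _ _ _.
Next Obligation. by move=> * /=; rewrite !fmap1. Qed.
Next Obligation. by move=> * /=; rewrite !fmapM. Qed.
Next Obligation. by move=> * /=; rewrite !fmap_linear. Qed.

Definition iterF (k : fieldType) (C : linCat k) (F : linFunctor C C) (n : nat) :
  linFunctor C C := iter n (compF F) (idF C).

Definition nat_isomorphic (k : fieldType) (C D : linCat k)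
    (F G : linFunctor C D) :=
  exists a : forall X, mor (F X) (G X),
    (forall X, is_iso (a X)) /\
    (forall X Y (f : mor X Y), a Y \oc fmap F f = fmap G f \oc a X).

Definition is_equivalence (k : fieldType) (C D : linCat k)
    (F : linFunctor C D) :=
  exists G : linFunctor D C,
    nat_isomorphic (compF G F) (idF C) /\ nat_isomorphic (compF F G) (idF D).

(** * Triangulated categories *)

(* [dist u v w] says that X -u-> Y -v-> Z -w-> susp X is distinguished.  The
   suspension is an autoequivalence, not necessarily a strict automorphism;
   stating the rotation axiom as an equivalence makes its inverse
   unnecessary. *)
Record triCat (k : fieldType) := TriCat {
  tcat :> linCat k;
  tcat_additive : is_additive tcat;
  susp : linFunctor tcat tcat;
  susp_equiv : is_equivalence susp;
  dist : forall X Y Z : tcat,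
    mor X Y -> mor Y Z -> mor Z (susp X) -> Prop;
  dist_iso : forall (X Y Z X' Y' Z' : tcat)
      (u : mor X Y) (v : mor Y Z) (w : mor Z (susp X))
      (u' : mor X' Y') (v' : mor Y' Z') (w' : mor Z' (susp X'))
      (a : mor X X') (b : mor Y Y') (c : mor Z Z'),
    is_iso a -> is_iso b -> is_iso c ->
    b \oc u = u' \oc a -> c \oc v = v' \oc b -> fmap susp a \oc w = w' \oc c ->
    dist u v w -> dist u' v' w';
  dist_id : forall X Z : tcat, is_zero Z ->
    dist (idm X) (0 : mor X Z) (0 : mor Z (susp X));
  dist_cone : forall (X Y : tcat) (u : mor X Y),
    exists (Z : tcat) (v : mor Y Z) (w : mor Z (susp X)), dist u v w;
  dist_rot : forall (X Y Z : tcat)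
      (u : mor X Y) (v : mor Y Z) (w : mor Z (susp X)),
    dist u v w <-> dist v w (- fmap susp u);
  dist_morph : forall (X Y Z X' Y' Z' : tcat)
      (u : mor X Y) (v : mor Y Z) (w : mor Z (susp X))
      (u' : mor X' Y') (v' : mor Y' Z') (w' : mor Z' (susp X'))
      (a : mor X X') (b : mor Y Y'),
    dist u v w -> dist u' v' w' -> b \oc u = u' \oc a ->
    exists c : mor Z Z', c \oc v = v' \oc b /\ fmap susp a \oc w = w' \oc c;
  dist_octahedral : forall (X Y Z U V W : tcat) (f : mor X Y) (g : mor Y Z)
      (f1 : mor Y U) (f2 : mor U (susp X))
      (h1 : mor Z V) (h2 : mor V (susp X))
      (g1 : mor Z W) (g2 : mor W (susp Y)),
    dist f f1 f2 -> dist (g \oc f) h1 h2 -> dist g g1 g2 ->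
    exists (a : mor U V) (b : mor V W),
      [/\ dist a b (fmap susp f1 \oc g2),
          a \oc f1 = h1 \oc g, h2 \oc a = f2,
          b \oc h1 = g1 & g2 \oc b = fmap susp f \oc h2] }.

Arguments susp {k} C : rename.

(** * Serre functors and the Calabi-Yau condition *)

Definition postcomp (k : fieldType) (C : linCat k) (X Y Z : C) (g : mor Y Z)
  (f : mor X Y) : mor X Z := g \oc f.

Lemma postcomp_linear (k : fieldType) (C : linCat k) (X Y Z : C)
  (g : mor Y Z) : linear (@postcomp k C X Y Z g).
Proof. by move=> a f f'; exact: comp_linearr. Qed.

HB.instance Definition _ (k : fieldType) (C : linCat k) (X Y Z : C)
    (g : mor Y Z) :=
  GRing.isLinear.Build k (mor X Y) (mor X Z) *:%R (postcomp g)
    (@postcomp_linear k C X Y Z g).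

(* ['Hom(mor X Y, k^o)] is the dual space D Hom(X, Y).  For each object X, phi
   is an isomorphism D Hom(X, -) -> Hom(-, S X) of contravariant functors; no
   naturality in X is asked for. *)
Definition is_serre_functor (k : fieldType) (C : linCat k)
    (S : linFunctor C C) :=
  is_equivalence S /\
  forall X : C,
    exists phi : forall Y : C, {linear 'Hom(mor X Y, k^o) -> mor Y (S X)},
      (forall Y, bijective (phi Y)) /\
      (forall (Y Y' : C) (g : mor Y Y') (l : 'Hom(mor X Y', k^o)),
         phi Y (l \o linfun (@postcomp k C X Y Y' g))%VF = phi Y' l \oc g).

(* S = susp^d for a Serre functor S, i.e. susp^d is itself a Serre functor; d is
   the least positive exponent with this property. *)
Definition calabi_yau (k : fieldType) (C : triCat k) (d : nat) :=
  [/\ (0 < d)%N, is_serre_functor (iterF (susp C) d)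
    & forall e : nat, (0 < e)%N -> (e < d)%N ->
        ~ is_serre_functor (iterF (susp C) e)].

(** * The opposite endomorphism algebra and the functor Hom(T, -) *)

(* End(T)^op: the product f * g is the composite g o f. *)
Definition endop (k : fieldType) (C : linCat k) (T : C) : Type := mor T T.

HB.instance Definition _ (k : fieldType) (C : linCat k) (T : C) :=
  GRing.Lmodule.copy (endop T) (mor T T).

Definition endop_one (k : fieldType) (C : linCat k) (T : C) : endop T := idm T.

Definition endop_mul (k : fieldType) (C : linCat k) (T : C)
  (f g : endop T) : endop T := mcomp (g : mor T T) (f : mor T T).

Lemma comp_addl (k : fieldType) (C : linCat k) (X Y Z : C) (f : mor X Y)
  (g g' : mor Y Z) : (g + g') \oc f = g \oc f + g' \oc f.
Proof. by have := comp_linearl 1 g g' f; rewrite !scale1r. Qed.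

Lemma comp_addr (k : fieldType) (C : linCat k) (X Y Z : C) (g : mor Y Z)
  (f f' : mor X Y) : g \oc (f + f') = g \oc f + g \oc f'.
Proof. by have := comp_linearr 1 g f f'; rewrite !scale1r. Qed.

Lemma endop_mulA (k : fieldType) (C : linCat k) (T : C) :
  associative (@endop_mul k C T).
Proof. by move=> f g h; rewrite /endop_mul compA. Qed.

Lemma endop_mul1r (k : fieldType) (C : linCat k) (T : C) :
  left_id (@endop_one k C T) (@endop_mul k C T).
Proof. by move=> f; exact: compm1. Qed.

Lemma endop_mulr1 (k : fieldType) (C : linCat k) (T : C) :
  right_id (@endop_one k C T) (@endop_mul k C T).
Proof. by move=> f; exact: comp1m. Qed.

Lemma endop_mulDl (k : fieldType) (C : linCat k) (T : C) :
  left_distributive (@endop_mul k C T) +%R.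
Proof. by move=> f g h; exact: comp_addr. Qed.

Lemma endop_mulDr (k : fieldType) (C : linCat k) (T : C) :
  right_distributive (@endop_mul k C T) +%R.
Proof. by move=> f g h; exact: comp_addl. Qed.

HB.instance Definition _ (k : fieldType) (C : linCat k) (T : C) :=
  GRing.Zmodule_isPzRing.Build (endop T) (@endop_mulA k C T)
    (@endop_mul1r k C T) (@endop_mulr1 k C T) (@endop_mulDl k C T)
    (@endop_mulDr k C T).

(* Hom(T, X) as a left module over End(T)^op, acting by precomposition. *)
Definition homT (k : fieldType) (C : linCat k) (T X : C) : Type := mor T X.

HB.instance Definition _ (k : fieldType) (C : linCat k) (T X : C) :=
  GRing.Zmodule.copy (homT T X) (mor T X).

Definition homT_act (k : fieldType) (C : linCat k) (T X : C)
  (a : endop T) (h : homT T X) : homT T X := mcomp (h : mor T X) (a : mor T T).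

Lemma homT_actA (k : fieldType) (C : linCat k) (T X : C) (a b : endop T)
  (h : homT T X) : homT_act a (homT_act b h) = homT_act (a * b) h.
Proof. by rewrite /homT_act -compA. Qed.

Lemma homT_act1 (k : fieldType) (C : linCat k) (T X : C) :
  left_id 1 (@homT_act k C T X).
Proof. by move=> h; exact: compm1. Qed.

Lemma homT_actDr (k : fieldType) (C : linCat k) (T X : C) :
  right_distributive (@homT_act k C T X) +%R.
Proof. by move=> a h h'; exact: comp_addl. Qed.

Lemma homT_actDl (k : fieldType) (C : linCat k) (T X : C) (h : homT T X) :
  {morph (@homT_act k C T X)^~ h : a b / a + b}.
Proof. by move=> a b; exact: comp_addr. Qed.

HB.instance Definition _ (k : fieldType) (C : linCat k) (T X : C) :=
  GRing.Zmodule_isLmodule.Build (endop T) (homT T X) (@homT_actA k C T X)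
    (@homT_act1 k C T X) (@homT_actDr k C T X) (@homT_actDl k C T X).

Definition homT_map (k : fieldType) (C : linCat k) (T X Y : C) (f : mor X Y)
  (h : homT T X) : homT T Y := f \oc h.

Lemma homT_map_linear (k : fieldType) (C : linCat k) (T X Y : C)
  (f : mor X Y) : linear (@homT_map k C T X Y f).
Proof.
by move=> a h h'; rewrite [LHS]comp_addr; congr (_ + _); exact: compA.
Qed.

HB.instance Definition _ (k : fieldType) (C : linCat k) (T X Y : C)
    (f : mor X Y) :=
  GRing.isLinear.Build (endop T) (homT T X) (homT T Y) *:%R
    (@homT_map k C T X Y f) (@homT_map_linear k C T X Y f).

Definition finitely_generated (A : pzRingType) (M : lmodType A) :=
  exists (n : nat) (e : 'I_n -> M),
    forall m : M, exists a : 'I_n -> A, m = \sum_i a i *: e i.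

Definition homT_full (k : fieldType) (C : linCat k) (T : C) :=
  forall (X Y : C) (phi : {linear homT T X -> homT T Y}),
    exists f : mor X Y, phi =1 homT_map f.

Definition homT_dense (k : fieldType) (C : linCat k) (T : C) :=
  forall M : lmodType (endop T), finitely_generated M ->
    exists (X : C) (phi : {linear homT T X -> M}), bijective phi.

(** * Schurian and cluster-tilting objects *)

(* An isomorphism of k-algebras; MathComp's [lalgType] is not available since
   End(X)^op may be the zero ring. *)
Definition schurian (k : fieldType) (C : linCat k) (X : C) :=
  exists phi : {linear k^o -> endop X},
    GRing.monoid_morphism (phi : k -> endop X) /\ bijective phi.

Definition cluster_tilting (k : fieldType) (C : triCat k) (T : C) :=
  (forall X : C, in_add T X <-> forall f : mor T (susp C X), f = 0) /\
  (forall X : C, in_add T X <-> forall f : mor X (susp C T), f = 0).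

(* Main.v *)
From HB Require Import structures.
From mathcomp Require Import all_boot all_order all_algebra.
Require Import Defs.

(** Write F for Hom(T, -) and S for the suspension; Hom(X, Y) and Hom(Y, S^2 X)
    are dual to each other. Of the two alternatives it is the second that is
    established: T is cluster-tilting.

    Fullness alone gives presentations ([presentation]): a local object X with
    F X nonzero is a retract of the cone Z of a map u : T1 -> T0 between
    summands of powers of T, and F kills the composite X -> Z -> S T1. Hence X is
    itself a summand of a power of T as soon as maps from X to S T that F kills
    are zero ([local_in_add]); by Serre duality there is a dual statement with
    S^2 T in place of T ([local_in_add_serre]).

    Density enters through the cokernel of F u for u : X -> T nonzero with X
    a local summand of a power of T. Comparing the object that realizes this
    cokernel with the cone of u shows that F (S u) is injective
    ([susp_injective]).

    T is rigid, i.e. Hom(T, S T) = 0 ([rigid]). Otherwise some local summand X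
    of T has F (S X) nonzero. By the two previous points S X is again a summand
    of a power of T, with the same property, and so are all suspensions of X.
    Nonzero maps X -> S^2 X exist by duality, and the injections that they induce
    make the dimensions of F (S^n X), n odd, a nondecreasing sequence, bounded by
    that of F (S T). Where two consecutive terms agree one finds an object Y such
    that every nonzero map Y -> S^2 Y is invertible. Through the Serre pairing Y
    splits off from the category, so by connectedness it is the only local object
    up to isomorphism, and S fixes the isomorphism class of every object. This
    would make the category 1-Calabi-Yau, contrary to the minimality of 2.

    Once T is rigid, a local X with F (S X) = 0 is a summand of a power of T by
    [local_in_add], unless F X = 0 too. The objects X with F X = F (S X) = 0 are
    stable under suspension and orthogonal on both sides to all other local
    objects ([unseen_susp], [orthogonal_unseen]), so they vanish by
    connectedness ([unseen_zero]). This is the cluster-tilting property; its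
    second half follows from the first by Serre duality. *)

Set Implicit Arguments.
Unset Strict Implicit.
Unset Printing Implicit Defensive.

Import GRing.Theory.
Local Open Scope ring_scope.

(** * Linear categories *)

Section LinearCategory.
Variables (k : fieldType) (C : linCat k).
Implicit Types X Y Z W : C.

Lemma comp0l X Y Z (f : mor X Y) : (0 : mor Y Z) \oc f = 0.
Proof.
by have := comp_linearl (-1) 0 (0 : mor Y Z) f;
  rewrite scaler0 addr0 scaleN1r addNr.
Qed.

Lemma comp0r X Y Z (g : mor Y Z) : g \oc (0 : mor X Y) = 0.
Proof.
by have := comp_linearr (-1) g 0 (0 : mor X Y);
  rewrite scaler0 addr0 scaleN1r addNr.
Qed.

Lemma compNl X Y Z (g : mor Y Z) (f : mor X Y) : (- g) \oc f = - (g \oc f).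
Proof. by apply/eqP; rewrite -addr_eq0 -comp_addl addNr comp0l. Qed.

Lemma compNr X Y Z (g : mor Y Z) (f : mor X Y) : g \oc (- f) = - (g \oc f).
Proof. by apply/eqP; rewrite -addr_eq0 -comp_addr addNr comp0r. Qed.

Lemma compBl X Y Z (g g' : mor Y Z) (f : mor X Y) :
  (g - g') \oc f = g \oc f - g' \oc f.
Proof. by rewrite comp_addl compNl. Qed.

Lemma compBr X Y Z (g : mor Y Z) (f f' : mor X Y) :
  g \oc (f - f') = g \oc f - g \oc f'.
Proof. by rewrite comp_addr compNr. Qed.

Lemma compZr X Y Z a (g : mor Y Z) (f : mor X Y) : g \oc (a *: f) = a *: (g \oc f).
Proof. by rewrite -[a *: f]addr0 comp_linearr comp0r addr0. Qed.

Lemma compZl X Y Z a (g : mor Y Z) (f : mor X Y) : (a *: g) \oc f = a *: (g \oc f).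
Proof. by rewrite -[a *: g]addr0 comp_linearl comp0l addr0. Qed.

Lemma comp_suml X Y Z (I : finType) (P : pred I) (g : I -> mor Y Z) (f : mor X Y) :
  (\sum_(i | P i) g i) \oc f = \sum_(i | P i) (g i \oc f).
Proof.
exact: (big_morph (fun g => g \oc f) (fun g g' => comp_addl f g g') (comp0l Z f)).
Qed.

Lemma comp_sumr X Y Z (I : finType) (P : pred I) (g : mor Y Z) (f : I -> mor X Y) :
  g \oc (\sum_(i | P i) f i) = \sum_(i | P i) (g \oc f i).
Proof.
exact: (big_morph (fun f => g \oc f) (fun f f' => comp_addr g f f') (comp0r X g)).
Qed.

Lemma id0_is_zero X : idm X = 0 -> is_zero X.
Proof.
by move=> X0 Y; split=> f; [rewrite -[f]compm1 | rewrite -[f]comp1m];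
  rewrite X0 ?comp0r ?comp0l.
Qed.

Lemma iso_comp X Y Z (g : mor Y Z) (f : mor X Y) :
  is_iso g -> is_iso f -> is_iso (g \oc f).
Proof.
move=> [g' [g'g gg']] [f' [f'f ff']]; exists (f' \oc g'); split.
  by rewrite -compA [g' \oc _]compA g'g comp1m f'f.
by rewrite -compA [f \oc _]compA ff' comp1m gg'.
Qed.

Lemma isomorphic_sym X Y : isomorphic X Y -> isomorphic Y X.
Proof. by move=> [f [g [gf fg]]]; exists g, f. Qed.

Lemma isomorphic_trans X Y Z : isomorphic X Y -> isomorphic Y Z -> isomorphic X Z.
Proof. by move=> [f If] [g Ig]; exists (g \oc f); apply: iso_comp. Qed.

(** The two summands of the identity, which is an isomorphism. *)
Lemma local_split X (e : mor X X) :
  has_local_end X -> is_iso e \/ is_iso (idm X - e).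
Proof.
by move=> [_ locX]; apply: locX; rewrite addrC subrK; exists (idm X); rewrite comp1m.
Qed.

(** The idempotent [f \oc g] is invertible or has invertible complement, and an
    invertible idempotent is the identity. *)
Lemma local_retract_iso X Y (f : mor X Y) (g : mor Y X) :
  has_local_end X -> has_local_end Y -> g \oc f = idm X -> is_iso f.
Proof.
move=> [X0 _] locY gf; exists g; split=> //.
have ee : (f \oc g) \oc (f \oc g) = f \oc g.
  by rewrite -compA [g \oc _]compA gf comp1m.
case: (local_split (f \oc g) locY) => -[h [h1 h2]].
  by rewrite -[LHS]comp1m -{1}h1 -compA ee h1.
suff e0 : f \oc g = 0.
  by case: X0; rewrite -[idm X]comp1m -gf -compA [f \oc _]compA e0 comp0l comp0r.
by rewrite -[LHS]comp1m -h1 -compA compBl comp1m ee subrr comp0r.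
Qed.

(** * Finite direct sums and dimensions of Hom spaces *)

(** Composing through a direct sum is multiplying a row by a column. *)
Lemma comp_through_dirsum (I : finType) (Xs : I -> C) X W Z
    (inj : forall i, mor (Xs i) X) (prj : forall i, mor X (Xs i))
    (f : forall i, mor (Xs i) Z) (g : forall i, mor W (Xs i)) :
  (forall i, prj i \oc inj i = idm (Xs i)) ->
  (forall i j, i != j -> prj j \oc inj i = 0) ->
  (\sum_i f i \oc prj i) \oc (\sum_i inj i \oc g i) = \sum_i f i \oc g i.
Proof.
move=> ii ij; rewrite comp_suml; apply: eq_bigr => i _.
rewrite comp_sumr (bigD1 i)//= big1 => [|j ji].
  by rewrite addr0 -compA [prj i \oc _]compA ii comp1m.
by rewrite -compA [prj i \oc _]compA ij// comp0l comp0r.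
Qed.

Lemma dirsum_isomorphic (I : finType) (Xs Ys : I -> C) X Y :
  is_dirsum Xs X -> is_dirsum Ys Y -> (forall i, isomorphic (Xs i) (Ys i)) ->
  isomorphic X Y.
Proof.
move=> [inj [prj [ii ij s]]] [inj' [prj' [ii' ij' s']]].
move=> /fin_all_exists[f] /fin_all_exists[g fg].
exists (\sum_i inj' i \oc f i \oc prj i), (\sum_i inj i \oc g i \oc prj' i).
split; (under [X in _ \oc X]eq_bigr do rewrite -compA); rewrite comp_through_dirsum//.
  rewrite -[RHS]s; apply: eq_bigr => i _.
  by rewrite compA -[_ \oc f i]compA (fg i).1 compm1.
rewrite -[RHS]s'; apply: eq_bigr => i _.
by rewrite compA -[_ \oc g i]compA (fg i).2 compm1.
Qed.

Lemma dirsum_hom0 (I : finType) (Xs : I -> C) X Y : is_dirsum Xs X ->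
  (forall i (f : mor (Xs i) Y), f = 0) -> forall f : mor X Y, f = 0.
Proof.
move=> [inj [prj [_ _ s]]] XY0 f; rewrite -[f]compm1 -s comp_sumr big1// => i _.
by rewrite compA [f \oc _]XY0 comp0l.
Qed.

Lemma hom0_dirsum (I : finType) (Xs : I -> C) X Y : is_dirsum Xs X ->
  (forall i (f : mor Y (Xs i)), f = 0) -> forall f : mor Y X, f = 0.
Proof.
move=> [inj [prj [_ _ s]]] XY0 f; rewrite -[f]comp1m -s comp_suml big1// => i _.
by rewrite -compA [prj i \oc f]XY0 comp0r.
Qed.

Lemma dirsum_neq0_r (I : finType) (Xs : I -> C) X (inj : forall i, mor (Xs i) X)
    (prj : forall i, mor X (Xs i)) Y (f : mor Y X) :
  \sum_i (inj i \oc prj i) = idm X -> f != 0 -> exists i, prj i \oc f != 0.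
Proof.
move=> id_sum f0; apply/existsP; apply: contraNT f0 => /existsPn p0.
rewrite -[f]comp1m -id_sum comp_suml big1// => i _.
by rewrite -compA; have /negPn/eqP-> := p0 i; rewrite comp0r.
Qed.

Lemma hom_dec X Y : (exists f : mor X Y, f != 0) \/ forall f : mor X Y, f = 0.
Proof.
have [X0|XY0] := eqVneq {:mor X Y}%VS 0%VS; [right|left].
  by move=> f; apply/eqP; rewrite -memv0 -X0 memvf.
by exists (vpick {:mor X Y}); rewrite vpick0.
Qed.

Lemma lker_postcomp0 X Y Z (h : mor Y Z) :
  (forall z : mor X Y, h \oc z = 0 -> z = 0) ->
  lker (linfun (@postcomp _ _ X _ _ h)) = 0%VS.
Proof.
move=> h_inj; apply/eqP; rewrite -subv0; apply/subvP => z.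
by rewrite memv_ker lfunE memv0 => /eqP/h_inj->.
Qed.

Lemma dim_le_of_injective X Y Z (h : mor Y Z) :
  (forall z : mor X Y, h \oc z = 0 -> z = 0) -> (\dim {:mor X Y} <= \dim {:mor X Z})%N.
Proof.
move=> /lker_postcomp0 ker0.
rewrite -(limg_dim_eq (f := linfun (@postcomp _ _ X _ _ h))) ?dimvS ?subvf//.
by rewrite ker0 capv0.
Qed.

Lemma surjective_of_dim_eq X Y Z (h : mor Y Z) :
  (forall z : mor X Y, h \oc z = 0 -> z = 0) -> \dim {:mor X Y} = \dim {:mor X Z} ->
  forall y : mor X Z, exists z, h \oc z = y.
Proof.
move=> /lker_postcomp0 ker0 dXY.
have /eqP imf : (limg (linfun (@postcomp _ _ X _ _ h)) == fullv)%VS.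
  rewrite eqEdim subvf -dXY limg_dim_eq ?leqnn//.
  by rewrite ker0 capv0.
move=> y; have /memv_imgP[z _ ->] : y \in limg (linfun (@postcomp _ _ X _ _ h)).
  by rewrite imf memvf.
by exists z; rewrite lfunE.
Qed.

End LinearCategory.

(** * Linear functors and equivalences *)

Section Functor.
Variables (k : fieldType) (C D : linCat k) (F : linFunctor C D).
Implicit Types X Y : C.

Lemma fmapD X Y (f g : mor X Y) : fmap F (f + g) = fmap F f + fmap F g.
Proof. by have := fmap_linear F 1 f g; rewrite !scale1r. Qed.

Lemma fmap0 X Y : fmap F (0 : mor X Y) = 0.
Proof. by apply: (addIr (fmap F 0)); rewrite -fmapD !add0r. Qed.

Lemma fmapN X Y (f : mor X Y) : fmap F (- f) = - fmap F f.
Proof. by apply/eqP; rewrite -addr_eq0 -fmapD addNr fmap0. Qed.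

Lemma fmap_sum X Y (I : finType) (f : I -> mor X Y) :
  fmap F (\sum_i f i) = \sum_i fmap F (f i).
Proof. exact: (big_morph (fmap F (X:=X) (Y:=Y)) (@fmapD X Y) (@fmap0 X Y)). Qed.

Lemma fmap_iso X Y (f : mor X Y) : is_iso f -> is_iso (fmap F f).
Proof.
by move=> [g [gf fg]]; exists (fmap F g); rewrite -!fmapM gf fg !fmap1.
Qed.

Lemma fmap_dirsum (I : finType) (Xs : I -> C) X :
  is_dirsum Xs X -> is_dirsum (fun i => F (Xs i)) (F X).
Proof.
move=> [inj [prj [pi pj s]]].
exists (fun i => fmap F (inj i)), (fun i => fmap F (prj i)); split.
- by move=> i; rewrite -fmapM pi fmap1.
- by move=> i j /pj; rewrite -fmapM => ->; rewrite fmap0.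
- by under eq_bigr do rewrite -fmapM; rewrite -fmap_sum s fmap1.
Qed.

Hypothesis Feq : is_equivalence F.

Lemma equiv_faithful X Y (f g : mor X Y) : fmap F f = fmap F g -> f = g.
Proof.
case: Feq => G [[a [aI aN]] _] fg.
have [b [_ ab]] := aI X.
have E h : h = a Y \oc fmap G (fmap F h) \oc b by rewrite aN /= -compA ab compm1.
by rewrite [f]E [g]E fg.
Qed.

(** Lift along the quasi-inverse, then compare after applying it; this uses
    that the quasi-inverse is faithful too. *)
Lemma equiv_full X Y (h : mor (F X) (F Y)) : exists f, fmap F f = h.
Proof.
case: Feq => G [[a [aI aN]] [b [bI bN]]].
have Gfaith (U V : D) (f g : mor U V) : fmap G f = fmap G g -> f = g.
  move=> fg; have [c [_ bc]] := bI U.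
  have E l : l = b V \oc fmap F (fmap G l) \oc c by rewrite bN /= -compA bc compm1.
  by rewrite [f]E [g]E fg.
have [a' [a'a aa']] := aI X; have [c [ca ac]] := aI Y.
exists (a Y \oc fmap G h \oc a'); apply: Gfaith.
have := aN _ _ (a Y \oc fmap G h \oc a') => /=.
rewrite -[RHS]compA a'a compm1 => /(congr1 (fun x => c \oc x)).
by rewrite !compA ca !comp1m.
Qed.

Lemma equiv_ess_surj (Y : D) : exists X, isomorphic (F X) Y.
Proof. by case: Feq => G [_ [b [bI _]]]; exists (G Y); exists (b Y); exact: bI. Qed.

Lemma equiv_eq0 X Y (f : mor X Y) : (fmap F f == 0) = (f == 0).
Proof.
apply/eqP/eqP=> [f0|->]; last exact: fmap0.
by apply: equiv_faithful; rewrite f0 fmap0.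
Qed.

Lemma equiv_iso X Y (f : mor X Y) : is_iso (fmap F f) -> is_iso f.
Proof.
move=> [h []]; have [g <-] := equiv_full h; rewrite -!fmapM -!fmap1.
by move=> /equiv_faithful gf /equiv_faithful fg; exists g.
Qed.

Lemma equiv_local X : has_local_end X -> has_local_end (F X).
Proof.
move=> [X0 locX]; split.
  by rewrite -fmap1 => /eqP; rewrite equiv_eq0 => /eqP/X0.
move=> f g; have [f' <-] := equiv_full f; have [g' <-] := equiv_full g.
by rewrite -fmapD => /equiv_iso /locX[]/fmap_iso; [left|right].
Qed.

End Functor.

(** * Exactness in triangulated categories *)

Section Triangulated.
Variables (k : fieldType) (C : triCat k).
Implicit Types X Y Z W : C.
Notation S := (susp C).

Lemma exists_zero : exists O : C, is_zero O.
Proof.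
have [O [inj [prj [_ _]]]] := tcat_additive
  (fun i : 'I_0 => False_rect C (notF (ltn_ord i))).
by rewrite big_ord0 => /esym /id0_is_zero; exists O.
Qed.

Lemma susp_zero X : is_zero X -> is_zero (S X).
Proof.
by move=> /(_ X)[/(_ (idm X)) X0 _]; apply: id0_is_zero; rewrite -fmap1 X0 fmap0.
Qed.

(** Compare the triangle on the identity of [X] with the given one. *)
Lemma dist_comp_vu0 X Y Z (u : mor X Y) (v : mor Y Z) (w : mor Z (S X)) :
  dist u v w -> v \oc u = 0.
Proof.
move=> tri; have [O O0] := exists_zero.
have [c [cE _]] := dist_morph (dist_id X O0) tri (erefl : u \oc idm X = u \oc idm X).
by rewrite -cE comp0r.
Qed.

Lemma dist_comp_wv0 X Y Z (u : mor X Y) (v : mor Y Z) (w : mor Z (S X)) :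
  dist u v w -> w \oc v = 0.
Proof. by move=> /dist_rot/dist_comp_vu0. Qed.

Lemma dist_comp_uw0 X Y Z (u : mor X Y) (v : mor Y Z) (w : mor Z (S X)) :
  dist u v w -> fmap S u \oc w = 0.
Proof.
move=> /dist_rot/dist_comp_wv0; rewrite compNl => /eqP.
by rewrite oppr_eq0 => /eqP.
Qed.

(** Exactness of Hom(-, A): [t] extends to a morphism to the triangle
    0 -> A -> A -> 0. *)
Lemma dist_weak_cokernel X Y Z (u : mor X Y) (v : mor Y Z) (w : mor Z (S X)) A
    (t : mor Y A) :
  dist u v w -> t \oc u = 0 -> exists t', t' \oc v = t.
Proof.
move=> tri tu0; have [O O0] := exists_zero.
have triA : dist (0 : mor O A) (idm A) (0 : mor A (S O)).
  apply/dist_rot; rewrite fmap0 oppr0; exact/dist_id/susp_zero.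
have [|c [cE _]] := dist_morph (a := 0) (b := t) tri triA.
  by rewrite tu0 comp0l.
by exists c; rewrite cE comp1m.
Qed.

(** Exactness of Hom(A, -): compare the rotated triangle on the identity of
    [A] with the rotation of the given one, and desuspend the third map. *)
Lemma dist_weak_kernel X Y Z (u : mor X Y) (v : mor Y Z) (w : mor Z (S X)) A
    (t : mor A Y) :
  dist u v w -> v \oc t = 0 -> exists t', u \oc t' = t.
Proof.
move=> tri vt0; have [O O0] := exists_zero.
have triA := proj1 (dist_rot _ _ _) (dist_id A O0).
have [|c [_]] := dist_morph (a := t) (b := 0) triA (proj1 (dist_rot _ _ _) tri).
  by rewrite vt0 comp0l.
have [t' <-] := equiv_full (susp_equiv C) c.
rewrite compNr compNl fmap1 compm1 -fmapM => /oppr_inj/(equiv_faithful (susp_equiv C)).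
by exists t'.
Qed.

(** The cone of [u] is a suspension up to isomorphism; rotate back, transporting
    along that isomorphism. *)
Lemma dist_fiber Y Z (u : mor Y Z) :
  exists X (v : mor X Y) (w : mor Z (S X)), dist v u w.
Proof.
have [V [v [w tri]]] := dist_cone u.
have [X [i [j [ji ij]]]] := equiv_ess_surj (susp_equiv C) V.
have [f fE] := equiv_full (susp_equiv C) (- (w \oc i)).
exists X, f, (j \oc v); apply/dist_rot.
apply: (dist_iso _ _ _ _ _ _ tri (a := idm Y) (b := idm Z) (c := j)); do ?[
  by exists (idm _); rewrite comp1m|by exists i|by rewrite ?comp1m ?compm1].
by rewrite fE opprK fmap1 comp1m -compA ij compm1.
Qed.

(** The complement is the cone of [f]: its third map vanishes because
    [f] is split, so the second one has a section, which is corrected by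
    [f \oc g] to be killed by [g]. *)
Lemma split_mono_dirsum2 X Y (f : mor X Y) (g : mor Y X) :
  g \oc f = idm X -> exists X', is_dirsum2 X X' Y.
Proof.
move=> gf; have [X' [v [w tri]]] := dist_cone f.
(* [fmap S f \oc w = 0], and [fmap S f] is a split monomorphism *)
have w0 : w = 0.
  by rewrite -[w]comp1m -fmap1 -gf fmapM -compA (dist_comp_uw0 tri) comp0r.
have [s' s'E] : exists s', v \oc s' = idm X'.
  apply: (dist_weak_kernel (proj1 (dist_rot _ _ _) tri)).
  by rewrite w0 comp0l.
pose s := s' - f \oc g \oc s'.
have vs : v \oc s = idm X'.
  by rewrite compBr s'E !compA (dist_comp_vu0 tri) !comp0l subr0.
have gs : g \oc s = 0 by rewrite compBr !compA gf comp1m subrr.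
have sum1 : f \oc g + s \oc v = idm Y.
  have [t tE] : exists t, f \oc t = idm Y - (f \oc g + s \oc v).
    apply: (dist_weak_kernel tri).
    rewrite compBr comp_addr !compA (dist_comp_vu0 tri) vs comp1m compm1 comp0l add0r.
    by rewrite subrr.
  suff t0 : t = 0 by apply/eqP; rewrite eq_sym -subr_eq0 -tE t0 comp0r.
  rewrite -[t]comp1m -gf -compA tE compBr comp_addr !compA gf gs comp1m compm1.
  by rewrite comp0l addr0 subrr.
exists X', (fun b => if b return mor (if b then X else X') Y then f else s),
  (fun b => if b return mor Y (if b then X else X') then g else v).
split; [by case|by case=> -[]//= _; rewrite ?gs ?(dist_comp_vu0 tri)|].
by rewrite big_bool.
Qed.

End Triangulated.

(** * The Serre pairing *)

Section Duality.
Variables (k : fieldType) (C : triCat k).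
Implicit Types X Y Z W : C.
Notation S := (susp C).

Lemma exists_dual (V : vectType k) (v : V) :
  v != 0 -> exists l : 'Hom(V, k^o), l v != 0.
Proof.
move=> v0.
pose l i : 'Hom(V, k^o) := linfun (coord (vbasis {:V}) i : V -> k^o).
have vE := coord_vbasis (memvf v).
have [i vi] : exists i, coord (vbasis {:V}) i v != 0.
  apply/existsP; apply: contraNT v0 => /existsPn vi.
  by rewrite vE big1// => i _; have /negPn/eqP-> := vi i; rewrite scale0r.
by exists (l i); rewrite lfunE.
Qed.

Hypothesis serre : is_serre_functor (iterF S 2).

(** The pairing Hom(X, Y) x Hom(Y, S^2 X) -> k given by composition and a
    trace form is nondegenerate: a linear form that does not kill [f]
    corresponds, by naturality in [Y], to such a [g]. *)
Lemma serre_pairing X Y (f : mor X Y) :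
  f != 0 -> exists g : mor Y (S (S X)), g \oc f != 0.
Proof.
move=> /exists_dual[l lf]; have [_ /(_ X)[phi [phiB phiN]]] := serre.
exists (phi Y l); rewrite -phiN; apply: contraNneq lf => lf0.
have /(bij_inj (phiB X))/lfunP/(_ (idm X)) :
    phi X (l \o linfun (@postcomp k C X X Y f))%VF = phi X 0.
  by rewrite lf0 linear0.
by rewrite comp_lfunE lfunE /= zero_lfunE /postcomp compm1 => ->.
Qed.

(** Nondegeneracy on the other side. It says that Hom(X, -) is faithful on maps
    to S^2 X. *)
Lemma serre_detect X Y (h : mor Y (S (S X))) :
  (forall z : mor X Y, h \oc z = 0) -> h = 0.
Proof.
have [_ /(_ X)[phi [phiB phiN]]] := serre.
have [psi psiK phiK] := phiB Y; move=> hz; rewrite -[h]phiK.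
suff -> : psi h = 0 by rewrite linear0.
apply/lfunP=> z; rewrite zero_lfunE.
have : phi X (psi h \o linfun (@postcomp k C X X Y z))%VF = 0.
  by rewrite phiN phiK hz.
rewrite -[RHS](linear0 (phi X)) => /(bij_inj (phiB X))/lfunP/(_ (idm X)).
rewrite comp_lfunE lfunE /= zero_lfunE /postcomp compm1; apply.
Qed.

Lemma hom0_serre X Y : (forall f : mor X Y, f = 0) -> forall g : mor Y (S (S X)), g = 0.
Proof. by move=> XY0 g; apply: serre_detect => z; rewrite [z]XY0 comp0r. Qed.

Lemma serre_hom0 X Y : (forall g : mor Y (S (S X)), g = 0) -> forall f : mor X Y, f = 0.
Proof.
move=> YX0 f; apply/eqP; apply: contraT => /serre_pairing[g].
by rewrite [g]YX0 comp0l eqxx.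
Qed.

End Duality.

(** * Additive closures and approximations *)

Section AdditiveClosure.
Variables (k : fieldType) (C : triCat k).
Implicit Types T X Y Z W : C.
Notation S := (susp C).

(** An elementwise form of being a summand of some T^n: it is immediately
    stable under retracts and finite sums, and every computation with maps from
    or to such an object reduces to maps from or to [T]. *)
Definition retract_of_power T X :=
  exists (n : nat) (a : 'I_n -> mor X T) (b : 'I_n -> mor T X),
    \sum_i b i \oc a i = idm X.

Lemma retract_of_powerP T X : retract_of_power T X <-> in_add T X.
Proof.
split=> [[n [a [b ba]]]|[n [P [X' [[inj [prj [_ _ s]]] [i [p [pi _ _]]]]]]]].
  have [P dP] := tcat_additive (fun _ : 'I_n => T).
  have [inj [prj [ii ij s]]] := dP.
  have [|X' dX] := @split_mono_dirsum2 _ _ X P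
    (\sum_i inj i \oc a i) (\sum_i b i \oc prj i).
    by rewrite comp_through_dirsum.
  by exists n, P, X'.
exists n, (fun j => prj j \oc i true), (fun j => p true \oc inj j).
rewrite -(pi true) -[i true in RHS]comp1m -s comp_suml comp_sumr.
by apply: eq_bigr => j _; rewrite !compA.
Qed.

Lemma retract_of_power_self T : retract_of_power T T.
Proof. by exists 1, (fun=> idm T), (fun=> idm T); rewrite big_ord1 comp1m. Qed.

Lemma retract_of_power_retract T X Y (f : mor X Y) (g : mor Y X) :
  g \oc f = idm X -> retract_of_power T Y -> retract_of_power T X.
Proof.
move=> gf [n [a [b ba]]]; exists n, (fun i => a i \oc f), (fun i => g \oc b i).
rewrite -gf -[f in RHS]comp1m -ba comp_suml comp_sumr.
by apply: eq_bigr => i _; rewrite !compA.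
Qed.

Lemma retract_of_power_detect T X Y (h h' : mor X Y) : retract_of_power T X ->
  (forall z : mor T X, h \oc z = h' \oc z) -> h = h'.
Proof.
move=> [n [a [b ba]]] hz; rewrite -[h]compm1 -[h']compm1 -ba !comp_sumr.
by apply: eq_bigr => i _; rewrite !compA hz.
Qed.

Lemma retract_of_power_codetect T X Y (h : mor Y X) : retract_of_power T X ->
  h != 0 -> exists a : mor X T, a \oc h != 0.
Proof.
move=> [n [a [b ba]]] h0; have [i ai] : exists i, a i \oc h != 0.
  apply/existsP; apply: contraNT h0 => /existsPn ah.
  rewrite -[h]comp1m -ba comp_suml big1// => i _.
  by have /negPn/eqP := ah i; rewrite -compA => ->; rewrite comp0r.
by exists (a i).
Qed.

Lemma retract_of_power_susp T X :
  retract_of_power T X -> retract_of_power (S T) (S X).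
Proof.
move=> [n [a [b ba]]]; exists n, (fun i => fmap S (a i)), (fun i => fmap S (b i)).
by under eq_bigr do rewrite -fmapM; rewrite -fmap_sum ba fmap1.
Qed.

Lemma retract_of_power_dirsum T (I : finType) (Xs : I -> C) X :
  is_dirsum Xs X -> (forall i, retract_of_power T (Xs i)) -> retract_of_power T X.
Proof.
move=> [inj [prj [_ _ s]]] TX.
pose good (f : mor X X) := exists n (a : 'I_n -> mor X T) (b : 'I_n -> mor T X),
  \sum_i b i \oc a i = f.
suff : good (idm X) by [].
rewrite -s; apply: big_ind => [|_ _ [n [a [b <-]]] [m [a' [b' <-]]]|i _].
- by exists 0, (fun=> 0), (fun=> 0); rewrite big_ord0.
- exists (n + m)%N, (fun i => match split i with inl i => a i | inr i => a' i end),
    (fun i => match split i with inl i => b i | inr i => b' i end).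
  rewrite big_split_ord; congr (_ + _); apply: eq_bigr => i _.
    by have := unsplitK (inl i : 'I_n + 'I_m) => /= ->.
  by have := unsplitK (inr i : 'I_n + 'I_m) => /= ->.
have [n [a [b ba]]] := TX i.
exists n, (fun j => a j \oc prj i), (fun j => inj i \oc b j).
rewrite -[prj i in RHS]comp1m -ba comp_suml comp_sumr.
by apply: eq_bigr => j _; rewrite !compA.
Qed.

(** Take one copy of [T] for each vector of a basis of Hom(T, X). *)
Lemma right_approximation T X : exists (T0 : C) (p : mor T0 X),
  retract_of_power T T0 /\ forall x : mor T X, exists y, p \oc y = x.
Proof.
pose e := vbasis {:mor T X}.
have [T0 dT0] := tcat_additive (fun _ : 'I_(\dim {:mor T X}) => T).
have [inj [prj [ii ij s]]] := dT0.
exists T0, (\sum_(i < \dim {:mor T X}) e`_i \oc prj i); split.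
  by apply: (retract_of_power_dirsum dT0) => _; apply: retract_of_power_self.
move=> x; exists (\sum_i coord e i x *: inj i).
rewrite [RHS](coord_vbasis (memvf x)) comp_sumr; apply: eq_bigr => i _.
rewrite compZr comp_suml (bigD1 i)//= big1 => [|j ji].
  by rewrite addr0 -compA ii compm1.
by rewrite -compA ij 1?eq_sym// comp0r.
Qed.

Lemma left_approximation T X : exists (T0 : C) (a : mor X T0),
  retract_of_power T T0 /\ forall x : mor X T, exists y, y \oc a = x.
Proof.
pose e := vbasis {:mor X T}.
have [T0 dT0] := tcat_additive (fun _ : 'I_(\dim {:mor X T}) => T).
have [inj [prj [ii ij s]]] := dT0.
exists T0, (\sum_(i < \dim {:mor X T}) inj i \oc e`_i); split.
  by apply: (retract_of_power_dirsum dT0) => _; apply: retract_of_power_self.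
move=> x; exists (\sum_i coord e i x *: prj i).
rewrite [RHS](coord_vbasis (memvf x)) comp_suml; apply: eq_bigr => i _.
rewrite compZl comp_sumr (bigD1 i)//= big1 => [|j ji].
  by rewrite addr0 compA ii comp1m.
by rewrite compA ij// comp0l.
Qed.

End AdditiveClosure.

(** * Modules: quotients and factorizations *)

Section ModuleOfAction.
Variables (A : pzRingType) (W : zmodType) (act : A -> W -> W).

Record action_axioms := ActionAxioms {
  action_mul : forall x y w, act x (act y w) = act (x * y) w;
  action_one : left_id 1 act;
  action_addr : right_distributive act +%R;
  action_addl : forall w, {morph act^~ w : x y / x + y} }.

Variable ax : action_axioms.

(** A synonym of [W] indexed by the proof of the axioms, so that the module
    structure is found by inference from the type. *)
Definition module_of_action of action_axioms : Type := W.

HB.instance Definition _ := GRing.Zmodule.on (module_of_action ax).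
HB.instance Definition _ := GRing.Zmodule_isLmodule.Build A (module_of_action ax)
  (action_mul ax) (action_one ax) (action_addr ax) (action_addl ax).

End ModuleOfAction.

Section Modules.
Variable A : pzRingType.

Lemma linear_factor (V W W' : lmodType A) (a : {linear V -> W}) (b : {linear V -> W'}) :
  (forall w, exists v, a v = w) -> (forall v, a v = 0 -> b v = 0) ->
  exists c : {linear W -> W'}, forall v, c (a v) = b v.
Proof.
move=> a_surj ab.
have a_surjb w : exists v, a v == w by have [v /eqP] := a_surj w; exists v.
pose c w := b (xchoose (a_surjb w)).
have cE v : c (a v) = b v.
  apply/eqP; rewrite -subr_eq0 -linearB; apply/eqP/ab.
  by rewrite linearB /= (eqP (xchooseP (a_surjb (a v)))) subrr.
have cL : linear c.
  move=> x w w'; have [v <-] := a_surj w; have [v' <-] := a_surj w'.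
  have -> : x *: a v + a v' = a (x *: v + v').
    exact: (esym (linearPZ a x v v')).
  by rewrite !cE; apply: linearPZ.
pose cl : {linear W -> W'} := HB.pack c (GRing.isLinear.Build A W W' *:%R c cL).
by exists cl.
Qed.

Lemma linear_lift (V W W' : lmodType A) (a : {linear W -> V}) (b : {linear W' -> V}) :
  (forall w, a w = 0 -> w = 0) -> (forall w', exists w, a w = b w') ->
  exists c : {linear W' -> W}, forall w', a (c w') = b w'.
Proof.
move=> a_ker ab; have a_inj w w' : a w = a w' -> w = w'.
  move=> /eqP; rewrite -subr_eq0 -linearB => /eqP/a_ker/eqP.
  by rewrite subr_eq0 => /eqP.
have abb w' : exists w, a w == b w' by have [v /eqP] := ab w'; exists v.
pose c w' := xchoose (abb w').
have cE w' : a (c w') = b w' by apply/eqP; rewrite (xchooseP (abb w')).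
have cL : linear c.
  move=> x w w'; apply: a_inj; rewrite cE; apply: etrans (linearPZ b x w w') _.
  by rewrite -!cE; apply: esym; apply: linearPZ.
pose cl : {linear W' -> W} := HB.pack c (GRing.isLinear.Build A W' W *:%R c cL).
by exists cl.
Qed.

(** Here [pi] presents [W] as a quotient abelian group of [V]; the action
    descends because the kernel of [pi] is stable, and is computed through
    the section [si]. *)
Lemma quotient_module (V : lmodType A) (W : zmodType) (pi : V -> W) (si : W -> V) :
  {morph pi : x y / x + y} -> cancel si pi ->
  (forall (x : A) v, pi v = 0 -> pi (x *: v) = 0) ->
  exists (M : lmodType A) (q : {linear V -> M}),
    (forall m, exists v, q v = m) /\ forall v, q v = 0 <-> pi v = 0.
Proof.
move=> piD siK piZ.
have pi0 : pi 0 = 0 by apply: (addIr (pi 0)); rewrite -piD !add0r.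
have piN v : pi (- v) = - pi v by apply/eqP; rewrite -addr_eq0 -piD addNr pi0.
have piE x v v' : pi v = pi v' -> pi (x *: v) = pi (x *: v').
  move=> vv'; apply/eqP; rewrite -subr_eq0 -piN -piD -scalerN -scalerDr.
  by rewrite piZ// piD piN vv' subrr.
pose act x w := pi (x *: si w).
have actA x y w : act x (act y w) = act (x * y) w.
  by rewrite /act -scalerA; apply: piE; rewrite siK.
have act1 : left_id 1 act by move=> w; rewrite /act scale1r siK.
have actDr : right_distributive act +%R.
  by move=> x w w'; rewrite /act -piD -scalerDr; apply: piE; rewrite piD !siK.
have actDl w : {morph act^~ w : x y / x + y}.
  by move=> x y; rewrite /act scalerDl piD.
pose M : lmodType A := module_of_action (ActionAxioms actA act1 actDr actDl).
have piL : linear (pi : V -> M).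
  by move=> x v v'; rewrite piD; congr (_ + _); apply: piE; rewrite siK.
pose q : {linear V -> M} := HB.pack (pi : V -> M)
  (GRing.isLinear.Build A V M *:%R (pi : V -> M) piL).
by exists M, q; split=> // m; exists (si m); apply: siK.
Qed.

End Modules.

(** * Consequences of fullness and density *)

Section FullDense.
Variables (k : fieldType) (C : linCat k) (T : C).

(** The maps [z |-> x] with [a \oc x = v \oc z] form a module
    morphism Hom(T, Z) -> Hom(T, X), which fullness realizes. *)
Lemma full_lift (homT_is_full : homT_full T) I X Z (a : mor X I) (v : mor Z I) :
  (forall x : mor T X, a \oc x = 0 -> x = 0) ->
  (forall z : mor T Z, exists x, a \oc x = v \oc z) ->
  exists g : mor Z X, forall z : mor T Z, a \oc (g \oc z) = v \oc z.
Proof.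
move=> a_inj av.
have [c cE] := @linear_lift (endop T) (homT T I) (homT T X) (homT T Z)
  (@homT_map _ _ T _ _ a) (@homT_map _ _ T _ _ v) a_inj av.
by have [g gE] := homT_is_full _ _ c; exists g => z; rewrite -[RHS]cE gE.
Qed.

(** Dual to [full_lift]: the module morphism sends [p \oc y] to
    [v \oc y]. *)
Lemma full_extension (homT_is_full : homT_full T) T0 X Z (p : mor T0 X) (v : mor T0 Z) :
  (forall x : mor T X, exists y, p \oc y = x) ->
  (forall y : mor T T0, p \oc y = 0 -> v \oc y = 0) ->
  exists f : mor X Z, forall y : mor T T0, f \oc p \oc y = v \oc y.
Proof.
move=> p_surj pv.
have [c cE] := @linear_factor (endop T) (homT T T0) (homT T X) (homT T Z)
  (@homT_map _ _ T _ _ p) (@homT_map _ _ T _ _ v) p_surj pv.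
by have [f fE] := homT_is_full _ _ c; exists f => y; rewrite -[RHS]cE fE -compA.
Qed.

(** The cokernel of Hom(T, u) is a cyclic module, generated by the class of the
    identity; density realizes it as some Hom(T, X), and [p] is the element of
    Hom(T, X) that corresponds to the generator. *)
Lemma dense_cokernel (homT_is_dense : homT_dense T) T' (u : mor T' T) :
  exists (X : C) (p : mor T X), (forall x : mor T X, exists y, p \oc y = x) /\
    forall y : mor T T, p \oc y = 0 <-> exists t, u \oc t = y.
Proof.
pose N := limg (linfun (@postcomp k C T T' T u)).
have NP y : reflect (exists t, u \oc t = y) (y \in N).
  apply: (iffP memv_imgP) => [[t _ ->]|[t <-]].
    by exists t; rewrite lfunE.
  by exists t; rewrite ?memvf// lfunE.
have dN : (N^C :&: N = 0)%VS by rewrite capvC capv_compl.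
pose pi (y : mor T T) : subvs_of N^C%VS := vsproj _ (daddv_pi N^C N y).
have piD : {morph pi : x y / x + y} by move=> x y; rewrite /pi !linearD.
have siK : cancel vsval pi.
  by move=> w; rewrite /pi daddv_pi_id ?subvsP// vsvalK.
have pi0 y : pi y = 0 <-> exists t, u \oc t = y.
  split=> [piy|/NP yN].
    apply/NP; have := @daddv_pi_add _ _ N^C%VS N y dN.
    rewrite addvC addv_complf => /(_ (memvf _)) <-.
    have /(congr1 vsval) := piy; rewrite vsprojK ?memv_pi// linear0 => ->.
    by rewrite add0r memv_pi.
  have := @daddv_pi_add _ _ N^C%VS N y dN; rewrite addvC addv_complf.
  move=> /(_ (memvf _)); rewrite (daddv_pi_id (capv_compl N) yN) => /eqP.
  by rewrite -[X in _ == X]add0r => /eqP/addIr; rewrite /pi => ->; rewrite linear0.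
have [|M [q [q_surj q0]]] := @quotient_module (endop T) (homT T T) _ pi vsval piD siK.
  by move=> x v /pi0[t tE]; apply/pi0; exists (t \oc x); rewrite compA tE.
have Mfg : finitely_generated M.
  exists 1, (fun=> q (idm T)) => m; have [v <-] := q_surj m.
  exists (fun=> v); rewrite big_ord1 -linearZ; congr (q _).
  by rewrite /= [RHS]comp1m.
have [X [phi [psi phiK psiK]]] := homT_is_dense M Mfg.
pose p : mor T X := psi (q (idm T)).
have pE y : phi (p \oc y) = q y.
  rewrite -[p \oc y]/((y : endop T) *: (p : homT T X)) linearZ /= psiK -linearZ.
  by congr (q _); rewrite /= [LHS]comp1m.
exists X, p; split=> [x|y].
  by have [y yE] := q_surj (phi x); exists y; rewrite -[LHS]phiK pE yE phiK.
apply: iff_trans (pi0 y); apply: iff_trans (q0 y); rewrite -pE.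
split=> [->|]; first exact: linear0.
by rewrite -(linear0 phi) => /(can_inj phiK).
Qed.

End FullDense.

(** * Presentations of local objects *)

Section Presentations.
Variables (k : fieldType) (C : triCat k) (T : C).
Notation S := (susp C).
Notation addT := (retract_of_power T).
Hypothesis homT_is_full : homT_full T.

(** Otherwise [idm X - e] would be invertible, yet it kills [z]. *)
Lemma local_fixing_iso X (e : mor X X) (z : mor T X) :
  has_local_end X -> z != 0 -> e \oc z = z -> is_iso e.
Proof.
move=> locX z0 ez; case: (local_split e locX) => // -[h [h1 _]].
case/eqP: z0; rewrite -[z]comp1m -h1 -compA compBl comp1m ez subrr.
exact: comp0r.
Qed.

(** The triangle is the cone of a projective presentation T1 -> T0 -> X made of
    approximations. The approximation T0 -> X factors through the cone, which
    gives [g]. In the other direction, Hom(T, X) is the cokernel of Hom(T, u),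
    hence maps to Hom(T, Z), and fullness realizes this by [f]. Then [g \oc f]
    fixes every map from [T] to [X], so it is invertible as [X] is local, and
    normalizing [f] makes it the identity. The last conclusion holds because
    every map from [T] to [X] comes from T0. *)
Lemma presentation X (z : mor T X) : has_local_end X -> z != 0 ->
  exists (T1 T0 Z : C) (u : mor T1 T0) (v : mor T0 Z) (w : mor Z (S T1))
    (f : mor X Z) (g : mor Z X),
  [/\ addT T1, addT T0, dist u v w, g \oc f = idm X
    & forall x : mor T X, w \oc f \oc x = 0].
Proof.
move=> locX z0; have [T0 [p [addT0 p_surj]]] := right_approximation T X.
have [K [i [ci triK]]] := dist_fiber p.
have [T1 [q [addT1 q_surj]]] := right_approximation T K.
pose u := i \oc q; have [Z [v [w tri]]] := dist_cone u.
have [g gv] : exists g, g \oc v = p.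
  by apply: (dist_weak_cokernel tri); rewrite compA (dist_comp_vu0 triK) comp0l.
have [f fE] : exists f : mor X Z, forall y : mor T T0, f \oc p \oc y = v \oc y.
  apply: full_extension => // y /(dist_weak_kernel triK)[y' <-].
  have [t <-] := q_surj y'.
  by rewrite [i \oc _]compA compA (dist_comp_vu0 tri) comp0l.
have fp : f \oc p = v by apply: retract_of_power_detect fE.
have [h [hgf gfh]] : is_iso (g \oc f).
  apply: local_fixing_iso locX z0 _; have [y <-] := p_surj z.
  by rewrite compA -[g \oc f \oc p]compA fp gv.
exists T1, T0, Z, u, v, w, (f \oc h), g; split=> // [|x]; first by rewrite compA.
have [y yE] := p_surj (h \oc x).
by rewrite compA -[w \oc f \oc h \oc x]compA -yE compA -[w \oc f \oc p]compA fp
  (dist_comp_wv0 tri) comp0l.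
Qed.

(** Present [X] as a retract of a cone. By hypothesis [w \oc f], whose
    target is a summand of some S T^n, vanishes; so [f] factors through T0. *)
Lemma local_in_add X (z : mor T X) : has_local_end X -> z != 0 ->
  (forall h : mor X (S T), (forall x : mor T X, h \oc x = 0) -> h = 0) -> addT X.
Proof.
move=> locX z0 hX.
have [T1 [T0 [Z [u [v [w [f [g [addT1 addT0 tri gf wfx]]]]]]]]] := presentation locX z0.
have wf0 : w \oc f = 0.
  have [//|wf0] := eqVneq (w \oc f) 0.
  have [a] := retract_of_power_codetect (retract_of_power_susp addT1) wf0.
  by rewrite [a \oc _]hX ?eqxx// => x; rewrite -compA wfx comp0r.
have [s sE] := dist_weak_kernel (proj1 (dist_rot _ _ _) tri) wf0.
by apply: (@retract_of_power_retract _ _ _ _ _ s (g \oc v)); rewrite // -compA sE.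
Qed.

Hypothesis serre : is_serre_functor (iterF S 2).

(** The dual of [local_in_add], where S^2 T plays the role of [T]: Hom(T, S^2 T)
    is dual to End(T), hence an injective module, and Z -> I0 -> I1 realizes an
    injective copresentation of Hom(T, X). The hypothesis makes the map from [Z]
    to [X] factor through I0. *)
Lemma local_in_add_serre X (z : mor T X) : has_local_end X -> z != 0 ->
  (forall h : mor (S T) X, h = 0) -> retract_of_power (S (S T)) X.
Proof.
move=> locX z0 hX.
have [I0 [a [addI0 a_inj]]] := left_approximation (S (S T)) X.
have [Y [c [d triY]]] := dist_cone a.
have [I1 [b [addI1 b_inj]]] := left_approximation (S (S T)) Y.
have [Z [v [w tri]]] := dist_fiber (b \oc c).
(* Maps out of [T] are detected by maps to S^2 T *)
have inj0 (A B : C) (e : mor A B) :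
    (forall x : mor A (S (S T)), exists y, y \oc e = x) ->
    forall x : mor T A, e \oc x = 0 -> x = 0.
  move=> e_surj x ex; have [//|/(serre_pairing serre)[g]] := eqVneq x 0.
  by have [y <-] := e_surj g; rewrite -compA ex comp0r eqxx.
have [f fE] : exists f, v \oc f = a.
  by apply: (dist_weak_kernel tri); rewrite -compA (dist_comp_vu0 triY) comp0r.
have [g gE] : exists g : mor Z X, forall y : mor T Z, a \oc (g \oc y) = v \oc y.
  apply: full_lift => // [|y]; first exact: inj0.
  have /(dist_weak_kernel triY)[x xE] : c \oc (v \oc y) = 0.
    by apply: (inj0 _ _ _ b_inj); rewrite !compA (dist_comp_vu0 tri) comp0l.
  by exists x.
have ag : a \oc g = v.
  apply/eqP; rewrite -subr_eq0; apply: contraT.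
  move=> /(retract_of_power_codetect addI0)[e] /eqP[].
  apply: (serre_detect serre) => y.
  by rewrite -compA compBl -compA gE subrr comp0r.
have [h [hgf _]] : is_iso (g \oc f).
  apply: local_fixing_iso locX z0 _; apply/eqP; rewrite -subr_eq0; apply/eqP.
  by apply: (inj0 _ _ _ a_inj); rewrite compBr !compA ag fE subrr.
have gw : fmap S g \oc w = 0.
  apply/eqP; apply: contraT => /eqP gw0; case: gw0.
  have [n [aa [bb ba]]] := addI1.
  rewrite -[w]compm1 -ba !comp_sumr big1// => i _.
  have [l lE] := equiv_full (susp_equiv C) (fmap S g \oc w \oc bb i).
  by rewrite !compA -lE [l]hX fmap0 comp0l.
have [t' tE] : exists t', t' \oc - fmap S v = fmap S g.
  apply: (dist_weak_cokernel _ gw).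
  exact: (proj1 (dist_rot _ _ _) (proj1 (dist_rot _ _ _) tri)).
have [t tE'] := equiv_full (susp_equiv C) t'.
have gtv : g = - t \oc v.
  apply: (equiv_faithful (susp_equiv C)).
  by rewrite fmapM fmapN tE' -tE compNr compNl.
apply: (@retract_of_power_retract _ _ _ _ _ a (h \oc (- t))) => //.
by rewrite -fE compA -[h \oc _ \oc v]compA -gtv -compA.
Qed.

End Presentations.

(** * Suspensions of maps between summands of T *)

Section SuspensionOfMaps.
Variables (k : fieldType) (C : triCat k) (T : C).
Notation S := (susp C).
Notation addT := (retract_of_power T).
Hypotheses (homT_is_full : homT_full T) (homT_is_dense : homT_dense T).

(** Let [Z] be the cone of [u] and [M] the object that realizes the cokernel
    of Hom(T, u). Fullness gives a map [f] from [M] to [Z], and there is [g]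
    backwards, such that [e = f \oc g] fixes the map from [T] to [Z]; so
    [1 - e = s \oc w] factors through S X. As S X is local,
    either [w \oc s] is invertible, which forces [u = 0], or
    [1 - w \oc s] is, and then [w] kills all maps from [T] to [Z], which
    by exactness is the injectivity claimed. *)
Lemma susp_injective_self X (u : mor X T) : has_local_end X -> addT X -> u != 0 ->
  forall z : mor T (S X), fmap S u \oc z = 0 -> z = 0.
Proof.
move=> locX addX u0 z uz.
have [M [p [p_surj pE]]] := dense_cokernel homT_is_dense u.
have [Z [v [w tri]]] := dist_cone u.
have vu := dist_comp_vu0 tri; have tri' := proj1 (dist_rot _ _ _) tri.
have [g gv] : exists g, g \oc v = p.
  apply: (dist_weak_cokernel tri); apply: (retract_of_power_detect addX) => y.
  by rewrite comp0l -compA; apply/pE; exists y.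
have [f fE] : exists f : mor M Z, forall y : mor T T, f \oc p \oc y = v \oc y.
  by apply: full_extension => // y /pE[t <-]; rewrite compA vu comp0l.
have {fE} fp : f \oc p = v by have := fE (idm T); rewrite !compm1.
have [s sE] : exists s, s \oc w = idm Z - f \oc g.
  apply: (dist_weak_cokernel tri').
  by rewrite compBl comp1m -compA gv fp subrr.
(* if [w \oc s] is invertible, [fmap S u \oc w = 0] forces [u = 0] *)
case: (local_split (w \oc s) (equiv_local (susp_equiv C) locX)) => -[h [h1 h2]].
  case/eqP: u0; apply: (equiv_faithful (susp_equiv C)); rewrite fmap0.
  by rewrite -[LHS]compm1 -h2 !compA (dist_comp_uw0 tri) !comp0l.
have [y yE] : exists y, w \oc y = z.
  by apply: (dist_weak_kernel (proj1 (dist_rot _ _ _) tri')); rewrite compNl uz oppr0.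
have [x xE] := p_surj (g \oc y).
rewrite -[z]comp1m -h1 -compA compBl comp1m -yE -compA [s \oc _]compA sE.
rewrite compBl comp1m [w \oc (_ - _)]compBr subKr -compA -xE.
rewrite [f \oc _]compA fp [w \oc _]compA.
by rewrite (dist_comp_wv0 tri) comp0l comp0r.
Qed.

Lemma susp_injective X Y (u : mor X Y) : has_local_end X -> addT X -> addT Y ->
  u != 0 -> forall z : mor T (S X), fmap S u \oc z = 0 -> z = 0.
Proof.
move=> locX addX addY /(retract_of_power_codetect addY)[a au] z uz.
by apply: (susp_injective_self locX addX au); rewrite fmapM -compA uz comp0r.
Qed.

End SuspensionOfMaps.

(** * Connectedness and local objects *)

Section Connectedness.
Variables (k : fieldType) (C : triCat k).
Implicit Types X Y Z W : C.
Notation S := (susp C).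

(** The sum of the summands selected by [b], as a retract of the whole. *)
Lemma partial_dirsum n (Xs : 'I_n -> C) X (inj : forall i, mor (Xs i) X)
    (prj : forall i, mor X (Xs i)) (b : pred 'I_n) :
  (forall i, prj i \oc inj i = idm (Xs i)) ->
  (forall i j, i != j -> prj j \oc inj i = 0) ->
  exists (A : C) (f : mor A X) (g : mor X A),
  [/\ is_dirsum (fun j : 'I_#|b| => Xs (enum_val j)) A, g \oc f = idm A
    & f \oc g = \sum_(i | b i) inj i \oc prj i].
Proof.
move=> ii ij.
have [A dA] := tcat_additive (fun j : 'I_#|b| => Xs (enum_val j)).
have [injA [prjA [iiA ijA sA]]] := dA.
exists A, (\sum_j inj (enum_val j) \oc prjA j), (\sum_j injA j \oc prj (enum_val j)).
split=> //; last first.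
  rewrite comp_through_dirsum// [RHS](eq_bigl (fun i => i \in b))//.
  by rewrite [RHS]big_enum_val.
rewrite (@comp_through_dirsum _ _ _ _ _ _ _ (fun j => inj (enum_val j))
  (fun j => prj (enum_val j)))// => i j ji.
by rewrite ij// (inj_eq enum_val_inj).
Qed.

(** Connectedness need only be tested on local objects: decompose an object into
    local ones and collect those in [P] and those in [Q]. *)
Lemma connected_local (P Q : C -> Prop) : krull_schmidt C -> connected C ->
  (forall n (Xs : 'I_n -> C) X, is_dirsum Xs X -> (forall i, P (Xs i)) -> P X) ->
  (forall n (Xs : 'I_n -> C) X, is_dirsum Xs X -> (forall i, Q (Xs i)) -> Q X) ->
  (forall A B, P A -> Q B ->
     (forall f : mor A B, f = 0) /\ (forall f : mor B A, f = 0)) ->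
  (forall X, has_local_end X -> P X \/ Q X) ->
  (forall A, P A -> is_zero A) \/ (forall B, Q B -> is_zero B).
Proof.
move=> ks conn Psum Qsum PQ0 PQ; apply: conn => // X.
have [n [Xs [[inj [prj [ii ij s]]] locXs]]] := ks X.
have /fin_all_exists[b bE] : forall i, exists b : bool,
    if b then P (Xs i) else Q (Xs i).
  by move=> i; case: (PQ _ (locXs i)); [exists true|exists false].
have [A [f [g [dA gf fg]]]] := partial_dirsum b ii ij.
have [B [f' [g' [dB gf' fg']]]] := partial_dirsum (predC b) ii ij.
have cross (b1 b2 : pred 'I_n) : (forall i, b1 i -> ~~ b2 i) ->
    (\sum_(i | b1 i) inj i \oc prj i) \oc (\sum_(i | b2 i) inj i \oc prj i) = 0.
  move=> b12; rewrite comp_suml big1// => i bi; rewrite comp_sumr big1// => j bj.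
  rewrite -compA [prj i \oc _]compA ij ?comp0l ?comp0r//.
  by apply: contraTneq bj => ->; apply: b12.
exists A, B; split.
- apply: (Psum _ _ _ dA) => j; have := bE (enum_val j).
  by have -> : b (enum_val j) by exact: (enum_valP j).
- apply: (Qsum _ _ _ dB) => j; have := bE (enum_val j).
  by have /negPf-> : predC b (enum_val j) by exact: (enum_valP j).
exists (fun c => if c return mor (if c then A else B) X then f else f'),
  (fun c => if c return mor X (if c then A else B) then g else g').
split; [by case| |].
  case=> -[]//= _.
    have -> : g' \oc f = g' \oc ((f' \oc g') \oc (f \oc g)) \oc f.
      by rewrite !compA gf' comp1m -compA gf compm1.
    by rewrite fg fg' cross// comp0r comp0l.
  have -> : g \oc f' = g \oc ((f \oc g) \oc (f' \oc g')) \oc f'.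
    by rewrite !compA gf comp1m -compA gf' compm1.
  by rewrite fg fg' cross ?comp0r ?comp0l// => i; rewrite /= negbK.
by rewrite big_bool /= fg fg' -s [RHS](bigID b).
Qed.

End Connectedness.

(** * Rigidity of T *)

Section Rigidity.
Variables (k : fieldType) (C : triCat k) (T : C).
Implicit Types X Y Z : C.
Notation S := (susp C).
Notation addT := (retract_of_power T).

(** If S X is isomorphic to [X] for every [X], then S^2 X may be replaced with
    S X in the Serre duality isomorphisms, so that S is a Serre functor already. *)
Lemma not_susp_isomorphic : calabi_yau C 2 -> ~ forall X : C, isomorphic (S X) X.
Proof.
move=> [_ [_ serre] /(_ 1 isT isT) not_serre] SX; apply: not_serre.
split.
  have [G [[a aP] [b bP]]] := susp_equiv C.
  by exists G; split; [exists a|exists b].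
move=> X; have [phi [phiB phiN]] := serre X.
have [i [j [ji ij]]] := SX (S X).
exists (fun Y => postcomp i \o phi Y); split=> [Y|Y Y' g l] /=; last first.
  by rewrite phiN /postcomp compA.
apply: bij_comp (phiB Y); exists (postcomp j) => f; rewrite /postcomp compA.
  by rewrite ji comp1m.
by rewrite ij comp1m.
Qed.

Hypotheses (C_krull_schmidt : krull_schmidt C) (C_connected : connected C).
Hypotheses (C_2CY : calabi_yau C 2).
Hypotheses (homT_is_full : homT_full T) (homT_is_dense : homT_dense T).

Let serre : is_serre_functor (iterF S 2). Proof. by case: C_2CY. Qed.

Lemma local_neq0 X : has_local_end X -> idm X != 0.
Proof. by move=> [/eqP]. Qed.

Lemma add_serre_neq0 X : has_local_end X -> addT X ->
  exists z : mor T (S (S X)), z != 0.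
Proof.
move=> locX addX; have [a] := retract_of_power_codetect addX (local_neq0 locX).
rewrite compm1 => /(serre_pairing serre)[g ga]; exists g.
by apply: contraNneq ga => ->; rewrite comp0l.
Qed.

(** Local summands of T^n that witness the failure of rigidity. They
    turn out not to exist. *)
Definition nonrigid_summand X :=
  [/\ has_local_end X, addT X & exists z : mor T (S X), z != 0].

(** A map from S X to S T killed by Hom(T, -) is the suspension of a map from [X]
    to [T], which by [susp_injective_self] vanishes; so [local_in_add]
    applies to S X. *)
Lemma nonrigid_summand_susp X : nonrigid_summand X -> nonrigid_summand (S X).
Proof.
move=> [locX addX [z z0]]; have locSX := equiv_local (susp_equiv C) locX.
split=> //; last exact: add_serre_neq0.
apply: (local_in_add homT_is_full locSX z0) => h hx.
have [h' h'E] := equiv_full (susp_equiv C) h.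
apply/eqP; rewrite -h'E equiv_eq0; last exact: susp_equiv.
apply: contraT => h'0; case/eqP: z0.
by apply: (susp_injective_self homT_is_full homT_is_dense locX addX h'0); rewrite h'E.
Qed.

Lemma nonrigid_summand_dim X Y (u : mor X Y) : nonrigid_summand X -> addT Y -> u != 0 ->
  (\dim {:mor T (S X)} <= \dim {:mor T (S Y)})%N.
Proof.
move=> [locX addX _] addY u0; apply: (@dim_le_of_injective _ _ _ _ _ (fmap S u)).
exact: susp_injective u0.
Qed.

(** Serre duality gives a nonzero map from [X] to S^2 X, so the dimensions of
    Hom(T, S X), Hom(T, S^3 X), Hom(T, S^5 X) and so on do not decrease;
    they are bounded by the dimension of Hom(T, S T), hence two consecutive ones
    agree. *)
Lemma nonrigid_summand_stable X : nonrigid_summand X ->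
  exists Y, nonrigid_summand Y /\ \dim {:mor T (S Y)} = \dim {:mor T (S (S (S Y)))}.
Proof.
have [m] := ubnP (\dim {:mor T (S T)} - \dim {:mor T (S X)})%N.
elim: m X => // m IH X lt_m nrX.
have nrX2 := nonrigid_summand_susp (nonrigid_summand_susp nrX).
have [locX addX _] := nrX.
have [u] := serre_pairing serre (local_neq0 locX); rewrite compm1 => u0.
have [locX2 addX2 _] := nrX2; have := nonrigid_summand_dim nrX addX2 u0.
rewrite leq_eqVlt => /predU1P[dX|lt_dim]; first by exists X.
apply: (IH (S (S X))) => //.
have [a a0] := retract_of_power_codetect addX2 (local_neq0 locX2).
have le_dim := nonrigid_summand_dim nrX2 (retract_of_power_self T) a0.
apply: leq_trans (_ : _ < \dim {:mor T (S T)} - \dim {:mor T (S X)})%N lt_m.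
by apply: ltn_sub2l => //; apply: leq_trans le_dim.
Qed.

(** For [Y] as in [nonrigid_summand_stable] every nonzero map from [Y] to
    S^2 Y is invertible. By the Serre pairing every nonzero map from [Y] to a
    local object can be continued to such a map, hence is invertible too. So
    the sums of copies of [Y] split off from the category, and connectedness
    leaves [Y] as the only local object up to isomorphism. Then the
    suspension fixes all objects up to isomorphism, contrary to
    [not_susp_isomorphic]. *)
Lemma no_nonrigid_summand X : ~ nonrigid_summand X.
Proof.
move=> /nonrigid_summand_stable[Y [nrY dY]] {X}.
have [locY addY _] := nrY; have [locSY addSY _] := nonrigid_summand_susp nrY.
have nrY2 := nonrigid_summand_susp (nonrigid_summand_susp nrY).
have [_ addY2 _] := nrY2; have [_ addSY2 _] := nonrigid_summand_susp nrY2.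
have iso_of_neq0 (u : mor Y (S (S Y))) : u != 0 -> is_iso u.
  move=> u0; have u_inj := susp_injective homT_is_full homT_is_dense locY addY addY2 u0.
  have u_surj := surjective_of_dim_eq u_inj dY.
  apply: (equiv_iso (susp_equiv C)).
  have [n [a [b ba]]] := addSY2.
  have /fin_all_exists[b' b'E] : forall i, exists y, fmap S u \oc y = b i by move=> i.
  have hs : fmap S u \oc (\sum_i b' i \oc a i) = idm _.
    by rewrite comp_sumr -ba; apply: eq_bigr => i _; rewrite compA b'E.
  exists (\sum_i b' i \oc a i); split=> //.
  apply: (retract_of_power_detect addSY) => x; rewrite comp1m.
  apply/eqP; rewrite -subr_eq0; apply/eqP/u_inj.
  by rewrite compBr !compA hs comp1m subrr.
have iso_target X (f : mor Y X) : has_local_end X -> f != 0 -> isomorphic Y X.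
  move=> locX /(serre_pairing serre)[g /iso_of_neq0[h [hgf _]]].
  exists f; apply: (@local_retract_iso _ _ _ _ f (h \oc g)) => //.
  by rewrite -compA.
have [] := @connected_local _ _ (retract_of_power Y)
  (fun X => forall f : mor Y X, f = 0) C_krull_schmidt C_connected.
- by move=> n Xs X; apply: retract_of_power_dirsum.
- by move=> n Xs X; apply: hom0_dirsum.
- move=> A B [n [a [b ba]]] B0; split=> f.
    rewrite -[f]compm1 -ba comp_sumr big1// => i _.
    by rewrite compA [f \oc _]B0 comp0l.
  have [v v0] : exists v : mor Y (S (S Y)), v != 0.
    by have [v] := serre_pairing serre (local_neq0 locY); rewrite compm1; exists v.
  have [v' [v'v _]] := iso_of_neq0 _ v0.
  rewrite -[f]comp1m -ba comp_suml big1// => i _.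
  rewrite -compA; suff -> : a i \oc f = 0 by rewrite comp0r.
  (* [Y] is isomorphic to S^2 Y, to which [B] does not map by duality *)
  by rewrite -[a i \oc f]comp1m -v'v -[v' \oc v \oc _]compA
    [v \oc _](hom0_serre serre B0) comp0r.
- move=> X locX; have [[f f0]|] := hom_dec Y X; last by right.
  left; have [f' [g' [gf fg]]] := iso_target _ _ locX f0.
  exists 1, (fun=> g'), (fun=> f'); by rewrite big_ord1.
- move=> /(_ Y (retract_of_power_self Y)) Y0; case/eqP: (local_neq0 locY).
  by have [/(_ (idm Y))] := Y0 Y.
move=> Q0; apply: (not_susp_isomorphic C_2CY) => X.
have iso_local Z : has_local_end Z -> isomorphic Y Z.
  move=> locZ; have [[f f0]|/Q0 Z0] := hom_dec Y Z; first exact: iso_target f0.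
  by have [_ /(_ (idm Z)) Z0'] := Z0 Z; case/eqP: (local_neq0 locZ).
have [n [Xs [dX locXs]]] := C_krull_schmidt X.
apply: (dirsum_isomorphic (fmap_dirsum S dX) dX) => i.
apply: isomorphic_trans (isomorphic_sym (iso_local _ _)) (iso_local _ (locXs i)).
by apply: equiv_local (locXs i); apply: susp_equiv.
Qed.

Lemma rigid (f : mor T (S T)) : f = 0.
Proof.
have [n [Xs [dT locXs]]] := C_krull_schmidt T.
move: f; apply: (hom0_dirsum (fmap_dirsum S dT)) => i z.
have [//|z0] := eqVneq z 0; case: (@no_nonrigid_summand (Xs i)).
split=> //; last by exists z.
have [inj [prj [ii _ _]]] := dT.
exact: retract_of_power_retract (ii i) (retract_of_power_self T).
Qed.

(** * Objects invisible to T *)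

Lemma susp_hom0 X Y :
  (forall f : mor X Y, f = 0) <-> (forall g : mor (S X) (S Y), g = 0).
Proof.
split=> XY0 f.
  by have [f' <-] := equiv_full (susp_equiv C) f; rewrite [f']XY0 fmap0.
by apply: (equiv_faithful (susp_equiv C)); rewrite fmap0.
Qed.

Lemma hom0_retract X Y Z (i : mor Y Z) (p : mor Z Y) : p \oc i = idm Y ->
  (forall f : mor X Z, f = 0) -> forall f : mor X Y, f = 0.
Proof. by move=> pi XZ0 f; rewrite -[f]comp1m -pi -compA [i \oc f]XZ0 comp0r. Qed.

Lemma hom0_add X Y Z : retract_of_power X Y ->
  (forall f : mor X Z, f = 0) -> forall f : mor Y Z, f = 0.
Proof.
by move=> addY XZ0 f; apply: (retract_of_power_detect addY) => z; rewrite comp0l.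
Qed.

Lemma local_summand Y Z (z : mor Y Z) : z != 0 ->
  exists (X : C) (i : mor X Z) (p : mor Z X),
  [/\ has_local_end X, p \oc i = idm X & p \oc z != 0].
Proof.
move=> z0; have [n [Xs [[inj [prj [ii _ s]]] locXs]]] := C_krull_schmidt Z.
by have [i zi] := dirsum_neq0_r s z0; exists (Xs i), (inj i), (prj i).
Qed.

(** Both sides are Serre dual, up to a suspension. *)
Lemma hom_to_suspT X :
  (forall f : mor T (S X), f = 0) <-> (forall f : mor X (S T), f = 0).
Proof.
split=> [/susp_hom0|] h0; first exact: (serre_hom0 serre h0).
exact: (proj2 (susp_hom0 _ _) (hom0_serre serre h0)).
Qed.

Lemma rigid_in_add X (z : mor T X) : has_local_end X -> z != 0 ->
  (forall f : mor T (S X), f = 0) -> addT X.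
Proof.
by move=> locX z0 /hom_to_suspT X0; apply: (local_in_add homT_is_full locX z0).
Qed.

(** These objects turn out to be stable under suspension and orthogonal to all
    other local objects. Below, [T] sees [X] if Hom(T, X) is nonzero. *)
Definition unseen X := (forall f : mor T X, f = 0) /\ (forall f : mor T (S X), f = 0).

(** Write [X] as S W. If Hom(T, W) were nonzero, a local summand [Y] of [W] that
    [T] sees would be a summand of some T^n by [rigid_in_add]; but then
    Hom(T, S^2 Y) is nonzero, while it is a summand of Hom(T, S X). *)
Lemma unseen_desusp X : unseen X -> forall f : mor (S T) X, f = 0.
Proof.
move=> [X0 SX0] f; have [W [j [j' [j'j jj']]]] := equiv_ess_surj (susp_equiv C) X.
apply: (hom0_retract jj') => {}f; have [f' <-] := equiv_full (susp_equiv C) f.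
have [->|/local_summand[Y [i [p [locY pi pf0]]]]] := eqVneq f' 0; first exact: fmap0.
have Spi : fmap S p \oc fmap S i = idm _ by rewrite -fmapM pi fmap1.
have SSpi : fmap S (fmap S p) \oc fmap S (fmap S i) = idm _ by rewrite -fmapM Spi fmap1.
have addY : addT Y.
  apply: (rigid_in_add locY pf0); apply: hom0_retract Spi _.
  exact: hom0_retract j'j X0.
have [z /eqP[]] := add_serre_neq0 locY addY.
move: z; apply: hom0_retract SSpi _.
apply: (@hom0_retract _ _ (S X) (fmap S j) (fmap S j')) => //.
by rewrite -fmapM j'j fmap1.
Qed.

(** If Hom(T, S^2 X) were nonzero, a local summand of S^2 X that [T] sees would be
    a summand of some S^2 T^n by [local_in_add_serre]; but maps from S^2 T to
    S^2 X are suspended from maps from [T] to [X], which vanish. *)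
Lemma unseen_susp X : unseen X -> unseen (S X).
Proof.
move=> [X0 SX0]; split=> // f.
have [//|/local_summand[Y [i [p [locY pi pf0]]]]] := eqVneq f 0.
have addY : retract_of_power (S (S T)) Y.
  apply: (local_in_add_serre homT_is_full serre locY pf0).
  exact: hom0_retract pi (proj1 (susp_hom0 _ _) SX0).
case/eqP: (local_neq0 locY); apply: hom0_add addY _ _.
exact: hom0_retract pi (proj1 (susp_hom0 _ _) (proj1 (susp_hom0 _ _) X0)).
Qed.

(** [X] is a retract of an extension of S T1 by T0, and neither of these maps to
    [Y]. *)
Lemma orthogonal_unseen X Y (z : mor T X) : has_local_end X -> z != 0 -> unseen Y ->
  forall f : mor X Y, f = 0.
Proof.
move=> locX z0 uY f; have [Y0 _] := uY.
have [T1 [T0 [Z [u [v [w [i [p [addT1 addT0 tri pi _]]]]]]]]] :=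
  presentation homT_is_full locX z0.
have [t tE] : exists t, t \oc w = f \oc p.
  apply: (dist_weak_cokernel (proj1 (dist_rot _ _ _) tri)).
  exact: hom0_add addT0 Y0 _.
rewrite -[f]compm1 -pi compA -tE.
by rewrite [t](hom0_add (retract_of_power_susp addT1) (unseen_desusp uY)) !comp0l.
Qed.

(** A local object [X] with Hom(T, X) nonzero is orthogonal on both sides to the
    unseen objects, the second side by Serre duality. The same holds if
    Hom(T, S X) is nonzero, since suspending is fully faithful and
    keeps objects unseen. So the category is the product of the unseen objects
    and their orthogonal, and the latter contains [T]. *)
Lemma unseen_zero (T_nonzero : ~ is_zero T) X : unseen X -> is_zero X.
Proof.
pose P X := forall Y, unseen Y ->
  (forall f : mor X Y, f = 0) /\ (forall f : mor Y X, f = 0).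
have P_seen Y (z : mor T Y) : has_local_end Y -> z != 0 -> P Y.
  move=> locY z0 Z uZ; split; first exact: orthogonal_unseen z0 uZ.
  apply: (serre_hom0 serre); apply: orthogonal_unseen z0 _ => //.
  exact/unseen_susp/unseen_susp.
have [] := @connected_local _ _ P unseen C_krull_schmidt C_connected.
- move=> n Xs Y dY PXs Z uZ; split.
    by apply: dirsum_hom0 dY _ => i; case: (PXs i Z uZ).
  by apply: hom0_dirsum dY _ => i; case: (PXs i Z uZ).
- move=> n Xs Y dY uXs; split; first by apply: hom0_dirsum dY _ => i; case: (uXs i).
  by apply: hom0_dirsum (fmap_dirsum S dY) _ => i; case: (uXs i).
- by move=> A B PA uB; apply: PA.
- move=> Y locY; have [[z z0]|Y0] := hom_dec T Y; first by left; apply: P_seen z0.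
  have [[z z0]|SY0] := hom_dec T (S Y); last by right.
  left=> Z uZ; have locSY := equiv_local (susp_equiv C) locY.
  have [YZ0 ZY0] := P_seen _ _ locSY z0 _ (unseen_susp uZ).
  by split; apply: (proj2 (susp_hom0 _ _)).
- move=> P0; case: T_nonzero; apply: P0 => Y uY; split; first by case: uY.
  by apply: (serre_hom0 serre); case: (unseen_susp uY).
- exact.
Qed.

(** A local [X] with Hom(T, S X) zero is unseen, hence zero, or a summand of some
    T^n by [rigid_in_add]. *)
Lemma rigid_cluster_tilting (T_nonzero : ~ is_zero T) : cluster_tilting T.
Proof.
suff addE X : in_add T X <-> forall f : mor T (S X), f = 0.
  by split=> X //; apply: iff_trans (addE X) (hom_to_suspT X).
apply: iff_trans (iff_sym (retract_of_powerP T X)) _; split=> [addX f|X0].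
  have [//|/(retract_of_power_codetect (retract_of_power_susp addX))[a]] :=
    eqVneq f 0.
  by rewrite [a \oc f]rigid eqxx.
have [n [Xs [dX locXs]]] := C_krull_schmidt X.
apply: (retract_of_power_dirsum dX) => i.
have Xi0 : forall f : mor T (S (Xs i)), f = 0.
  have [inj [prj [ii _ _]]] := fmap_dirsum S dX.
  exact: hom0_retract (ii i) X0.
have [[z z0]|Ti0] := hom_dec T (Xs i); first exact: rigid_in_add z0 Xi0.
have [/(_ (idm (Xs i)))] := @unseen_zero T_nonzero (Xs i) (conj Ti0 Xi0) (Xs i).
by have /eqP := local_neq0 (locXs i).
Qed.

End Rigidity.

Theorem theorem2 (k : fieldType) (C : triCat k)
    (C_krull_schmidt : krull_schmidt C)
    (C_connected : connected C)
    (C_2CY : calabi_yau C 2)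
    (C_finite : finitely_many_indecomposables C)
    (T : C) (T_nonzero : ~ is_zero T)
    (homT_is_full : homT_full T) (homT_is_dense : homT_dense T) :
  schurian T \/ cluster_tilting T.
Proof.
right; exact: rigid_cluster_tilting.
Qed.
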